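(* There are $F$ and $G$ such that the following hold. (1) $F$ is an interpretation of $\mathbf K^+$ into $\mathbf K^*$: for every $A\in\mathbf K^*$ there is a $\tau^+$-structure $F(A)\in\mathbf K^+$ definable without parameters in $A$ (uniformly in $A$). (2) $G$ is an interpretation of $\mathbf K^*$ into $\mathbf K^+$: for every $B\in\mathbf K^+$ there is a $\tau$-structure $G(B)\in\mathbf K^*$ definable without parameters in $B$ (uniformly in $B$). (3) For every $A\in\mathbf K^*$, $G(F(A))$ is definably isomorphic to $A$, and for every $B\in\mathbf K^+$, $F(G(B))$ is definably isomorphic to $B$. Thus $F$ and $G$ give a bi-interpretation between $\mathbf K^*$ and $\mathbf K^+$.
   Context: One-sorted linear spaces: $\tau$ has a single ternary relation symbol $R$; $\mathbf K^*$ is the class of $\tau$-structures in which $R$ holds only of triples of pairwise distinct elements, $R$ is invariant under permutations of its arguments, and $R(x,y,z)\wedge R(x,y,w)\wedge z\ne w\rightarrow R(x,w,z)$. Two-sorted linear spaces: $\tau^+$ has unary predicates $P$ (points) and $L$ (lines), which are the two sorts, and a binary relation $I$ (incidence, between points and lines); $\mathbf K^+$ is the class of $\tau^+$-structures such that (A) any two distinct points lie on exactly one line and (B) each line contains at least two points. Empty structures are allowed. ''Definable without parameters in $A$'' is meant in the sense of (possibly multi-dimensional) interpretations: the universe and relations of the defined structure are given, by formulas without parameters, as a definable subset of a finite Cartesian power of $A$ (or a finite disjoint union of such) modulo a definable equivalence relation, with definable relations. *)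

(* Defs.v *)
From HB Require Import structures.
From mathcomp Require Import all_boot fingroup perm.

Set Implicit Arguments.
Unset Strict Implicit.
Unset Printing Implicit Defensive.

Record language := Language { symbol : Type; arity : symbol -> nat }.

(* Carriers may be empty, and equality of the structure is Leibniz equality. *)
Record structure (L : language) := Structure {
  carrier :> Type;
  holds : forall r : symbol L, ('I_(arity r) -> carrier) -> Prop }.

(* [formula L V] is the type of formulas whose free variables are in [V].  A
   quantifier binds the variable [None] of [option V].  No constant for an
   element of a structure is available, so definability by a formula is
   definability without parameters. *)
Inductive formula (L : language) : Type -> Type :=
| FFalse V : formula L V
| FEq V (x y : V) : formula L V
| FRel V (r : symbol L) (x : 'I_(arity r) -> V) : formula L V
| FImp V (f g : formula L V) : formula L V
| FAnd V (f g : formula L V) : formula L V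
| FOr V (f g : formula L V) : formula L V
| FAll V (f : formula L (option V)) : formula L V
| FEx V (f : formula L (option V)) : formula L V.

Fixpoint sat (L : language) (A : structure L) (V : Type) (f : formula L V) :
    (V -> A) -> Prop :=
  match f in formula _ V return (V -> A) -> Prop with
  | FFalse _ => fun _ => False
  | FEq _ x y => fun e => e x = e y
  | FRel _ r x => fun e => holds (fun i => e (x i))
  | FImp _ f g => fun e => sat f e -> sat g e
  | FAnd _ f g => fun e => sat f e /\ sat g e
  | FOr _ f g => fun e => sat f e \/ sat g e
  | FAll _ f => fun e => forall a : A, sat f (oapp e a)
  | FEx _ f => fun e => exists a : A, sat f (oapp e a)
  end.

(* The formulas which define an [L']-structure in an [L]-structure [A]: its
   universe is a quotient of a definable subset of the finite disjoint union of
   the powers [A ^ dim p], for [p : piece]. *)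
Record interpretation (L L' : language) := Interpretation {
  piece : finType;
  dim : piece -> nat;
  domF : forall p : piece, formula L 'I_(dim p);
  eqvF : forall p q : piece, formula L ('I_(dim p) + 'I_(dim q));
  relF : forall (r : symbol L') (p : 'I_(arity r) -> piece),
    formula L {i : 'I_(arity r) & 'I_(dim (p i))} }.

Section Interpret.
Variables (L L' : language) (F : interpretation L L') (A : structure L).

Definition code : Type := {p : piece F & 'I_(dim p) -> A}.

Definition in_dom (x : code) : Prop := sat (domF (tag x)) (tagged x).

Definition eqv (x y : code) : Prop :=
  sat (eqvF (tag x) (tag y))
    (fun k => match k with inl i => tagged x i | inr j => tagged y j end).

Definition rel_code (r : symbol L') (x : 'I_(arity r) -> code) : Prop :=
  sat (relF (fun i => tag (x i))) (fun k => tagged (x (tag k)) (tagged k)).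

(* The formulas of [F] do define a structure in [A]: an equivalence relation on
   the domain, and relations that do not depend on representatives. *)
Definition well_defined : Prop :=
  [/\ forall x, in_dom x -> eqv x x,
      forall x y, in_dom x -> in_dom y -> eqv x y -> eqv y x,
      forall x y z, in_dom x -> in_dom y -> in_dom z ->
        eqv x y -> eqv y z -> eqv x z
    & forall (r : symbol L') (x y : 'I_(arity r) -> code),
        (forall i, [/\ in_dom (x i), in_dom (y i) & eqv (x i) (y i)]) ->
        rel_code x -> rel_code y].

Definition eqv_class (x : code) : code -> Prop :=
  fun y => in_dom y /\ eqv x y.

Definition quotient : Type :=
  {C : code -> Prop | exists2 x, in_dom x & C = eqv_class x}.

Definition represents (x : code) (c : quotient) : Prop := sval c x.

Definition interpret : structure L' :=
  @Structure L' quotient (fun r c =>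
    exists2 x : 'I_(arity r) -> code,
      forall i, represents (x i) (c i) & rel_code x).

End Interpret.

Definition is_isomorphism (L : language) (A B : structure L) (f : A -> B) :=
  bijective f /\
  forall (r : symbol L) (x : 'I_(arity r) -> A),
    holds x <-> holds (fun i => f (x i)).

Definition interprets_class (L L' : language) (F : interpretation L L')
    (K : structure L -> Prop) (K' : structure L' -> Prop) : Prop :=
  forall A, K A -> well_defined F A /\ K' (interpret F A).

Section DefinableIsomorphism.
Variables (L L' : language).
Variables (F : interpretation L L') (G : interpretation L' L).

(* An element of G(F(A)) is given by a piece [q] of [G] and [dim q] elements of
   F(A), the [i]-th of which is given by a piece [p i] of [F] and a tuple of
   [dim (p i)] elements of [A]. *)
Definition represents2 (A : structure L) (q : piece G)
    (p : 'I_(dim q) -> piece F) (a : {i : 'I_(dim q) & 'I_(dim (p i))} -> A)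
    (c : interpret G (interpret F A)) : Prop :=
  exists2 b : 'I_(dim q) -> interpret F A,
    forall i, represents (existT _ (p i) (fun j => a (existT _ i j))) (b i)
    & represents (existT _ q b) c.

(* Formulas for the graph of a map from G(F(A)) to A; the variable [None]
   stands for the value of the map. *)
Definition graph_formulas : Type :=
  forall (q : piece G) (p : 'I_(dim q) -> piece F),
    formula L (option {i : 'I_(dim q) & 'I_(dim (p i))}).

Definition defines_map (phi : graph_formulas) (A : structure L)
    (f : interpret G (interpret F A) -> A) : Prop :=
  forall (q : piece G) (p : 'I_(dim q) -> piece F)
    (a : {i : 'I_(dim q) & 'I_(dim (p i))} -> A) (y : A),
    sat (phi q p) (oapp a y) <-> exists2 c, represents2 a c & f c = y.

(* The same formulas [phi] serve for every [A] in [K]. *)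
Definition definably_isomorphic_on (K : structure L -> Prop) : Prop :=
  exists phi : graph_formulas, forall A, K A ->
    exists2 f : interpret G (interpret F A) -> A,
      is_isomorphism f & defines_map phi f.

End DefinableIsomorphism.

Inductive tau_symbol : Type := Rsym.

Definition tau : language := @Language tau_symbol (fun _ => 3).

Definition R (A : structure tau) (x y z : A) : Prop :=
  @holds tau A Rsym (tnth [tuple x; y; z]).

Definition one_sorted_linear_space (A : structure tau) : Prop :=
  [/\ forall x y z : A, R x y z -> [/\ x <> y, x <> z & y <> z],
      forall (s : 'S_3) (v : 'I_3 -> A),
        @holds tau A Rsym v -> @holds tau A Rsym (fun i => v (s i))
    & forall x y z w : A, R x y z -> R x y w -> z <> w -> R x w z].

Inductive tau_plus_symbol : Type := Psym | Lsym | Isym.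

Definition tau_plus : language :=
  @Language tau_plus_symbol
    (fun r => match r with Psym => 1 | Lsym => 1 | Isym => 2 end).

Definition point (B : structure tau_plus) (x : B) : Prop :=
  @holds tau_plus B Psym (tnth [tuple x]).

Definition line (B : structure tau_plus) (x : B) : Prop :=
  @holds tau_plus B Lsym (tnth [tuple x]).

Definition incident (B : structure tau_plus) (x y : B) : Prop :=
  @holds tau_plus B Isym (tnth [tuple x; y]).

(* Two-sorted linear spaces: points and lines are the two sorts, so they
   partition the universe, and incidence is between a point and a line. *)
Definition two_sorted_linear_space (B : structure tau_plus) : Prop :=
  [/\ forall x : B, (point x \/ line x) /\ ~ (point x /\ line x),
      forall x y : B, incident x y -> point x /\ line y,
      forall x y : B, point x -> point y -> x <> y ->
        exists! l : B, [/\ line l, incident x l & incident y l]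
    & forall l : B, line l -> exists x y : B,
        [/\ point x, point y, x <> y, incident x l & incident y l]].

(* Main.v *)
(** A one-sorted space [A] interprets in itself the structure whose elements
    are the sets [collinear x y] of points on the line through [x] and [y],
    coded by the pair [(x, y)]: this set is the singleton [{x}] when [x = y],
    and a line otherwise.  Two pairs code the same element iff they span the
    same set, so points and lines come from a single two-dimensional piece.
    Conversely, a two-sorted space interprets on its set of points the relation
    of being distinct and on a common line.  The exchange axiom of [K*] says
    that any two distinct points of [collinear x y] span it. *)
Require Import Defs.
From mathcomp Require Import all_boot.
From mathcomp Require Import fingroup perm boolp.

Set Implicit Arguments.
Unset Strict Implicit.
Unset Printing Implicit Defensive.

(** * Assignments on small ordinals as explicit tuples *)

Notation "#0" := (@Ordinal _.+1 0 isT).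
Notation "#1" := (@Ordinal _.+2 1 isT).
Notation "#2" := (@Ordinal _.+3 2 isT).

Lemma fun_ord1 (T : Type) (f : 'I_1 -> T) : f = tnth [tuple f #0].
Proof.
by apply/funext; case=> -[|//] i; congr f; apply: val_inj.
Qed.

Lemma fun_ord2 (T : Type) (f : 'I_2 -> T) : f = tnth [tuple f #0; f #1].
Proof.
by apply/funext; case=> -[|[|//]] i; congr f; apply: val_inj.
Qed.

Lemma fun_ord3 (T : Type) (f : 'I_3 -> T) : f = tnth [tuple f #0; f #1; f #2].
Proof.
by apply/funext; case=> -[|[|[|//]]] i; congr f; apply: val_inj.
Qed.

(** * Quotients by definable equivalence relations *)

Section Quotient.
Variables (L L' : language) (F : interpretation L L') (A : structure L).
Hypothesis wdF : well_defined F A.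
Implicit Types (x y : code F A) (c d : interpret F A).

Lemma represents_in_dom x c : represents x c -> in_dom x.
Proof. by case: c => C [y Dy EC]; rewrite /represents /= EC => -[]. Qed.

Lemma represents_surj c : exists x, represents x c.
Proof.
case: wdF => refl _ _ _; case: c => C [x Dx EC]; exists x.
by rewrite /represents /= EC; split=> //; apply: refl.
Qed.

Lemma represents_total x : in_dom x -> exists c, represents x c.
Proof.
move=> Dx; pose C : interpret F A := exist _ (eqv_class x) (ex_intro2 _ _ x Dx erefl).
by exists C; split=> //; case: wdF => refl _ _ _; apply: refl.
Qed.

(** By symmetry and transitivity, every representative generates the same class as the code hidden
    in the existential proof of [c]. *)
Lemma sval_represents x c : represents x c -> sval c = eqv_class x.
Proof.
case: wdF => _ sym trans _; case: c => C [y Dy EC].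
rewrite /represents /= EC => -[Dx yx]; apply/funext => z; apply/propext.
split=> -[Dz hz]; split=> //; last exact: (trans y x z).
by apply: (trans x y z) => //; apply: sym.
Qed.

Lemma represents_eq x y c d : represents x c -> represents y d ->
  (c = d <-> eqv x y).
Proof.
move=> xc yd; split=> [cd|xy].
  by move: yd; rewrite -cd /represents (sval_represents xc) => -[].
(* A quotient element is a predicate packed with a proof, so proof irrelevance reduces equality to
   that of the predicates. *)
apply: eq_sig_hprop => [? ? ?|]; first exact: Prop_irrelevance.
have yc : represents y c.
  by rewrite /represents (sval_represents xc); split=> //; apply: represents_in_dom yd.
exact: etrans (sval_represents yc) (esym (sval_represents yd)).
Qed.

(** The quotient relation only asks for some representatives; invariance under [eqv] carries it over
    to the given ones. *)
Lemma holds_represents (r : symbol L') (x : 'I_(arity r) -> code F A)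
    (c : 'I_(arity r) -> interpret F A) :
  (forall i, represents (x i) (c i)) -> (@holds _ (interpret F A) r c <-> rel_code x).
Proof.
move=> xc; split; last by exists x.
case=> y yc; case: (wdF) => _ _ _; apply=> i; split.
- exact: represents_in_dom (yc i).
- exact: represents_in_dom (xc i).
by apply/(represents_eq (yc i) (xc i)).
Qed.

End Quotient.

(** The isomorphism is described by its graph [Gamma]; choice then yields the map and its inverse.
    The third hypothesis says at once that [Gamma] is single-valued and that it is injective. *)
Lemma definable_isomorphism (L L' : language) (F : interpretation L L')
    (G : interpretation L' L) (A : structure L) (phi : graph_formulas F G)
    (Gamma : interpret G (interpret F A) -> A -> Prop) :
  (forall c, exists y, Gamma c y) -> (forall y, exists c, Gamma c y) ->
  (forall c d y z, Gamma c y -> Gamma d z -> (c = d <-> y = z)) ->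
  (forall r c y, (forall i : 'I_(arity r), Gamma (c i) (y i)) ->
     (@holds _ (interpret G (interpret F A)) r c <-> holds y)) ->
  (forall q p a y, sat (phi q p) (oapp a y) <->
     exists2 c, represents2 a c & Gamma c y) ->
  exists2 f : interpret G (interpret F A) -> A,
    is_isomorphism f & defines_map phi f.
Proof.
move=> total surj inj rel def_phi.
have [f fP] := choice total; have [h hP] := choice surj.
have fE c y : f c = y <-> Gamma c y.
  by split=> [<- //|cy]; apply/(inj _ _ _ _ (fP c) cy).
exists f; first split.
- by exists h => z; [apply/(inj _ _ _ _ (hP _) (fP z)) | apply/fE].
- by move=> r x; apply: rel.
move=> q p a y; rewrite def_phi.
by split=> -[c ac cy]; exists c => //; apply/fE.
Qed.

(** * Spans of pairs in a one-sorted linear space *)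

Section OneSorted.
Variable A : structure tau.
Hypothesis KA : one_sorted_linear_space A.
Implicit Types x y z u v w : A.

Definition collinear x y z := [\/ z = x, z = y | R x y z].

Lemma R_distinct x y z : R x y z -> [/\ x <> y, x <> z & y <> z].
Proof. by case: KA => + _ _; apply. Qed.

Lemma R_swap12 x y z : R x y z -> R y x z.
Proof.
case: KA => _ RS _ /(RS (tperm #0 #1)); rewrite /R; congr holds.
by rewrite [LHS]fun_ord3 !permE.
Qed.

Lemma R_swap23 x y z : R x y z -> R x z y.
Proof.
case: KA => _ RS _ /(RS (tperm #1 #2)); rewrite /R; congr holds.
by rewrite [LHS]fun_ord3 !permE.
Qed.

Lemma collinear_diag x z : collinear x x z <-> z = x.
Proof.
by split=> [[//|//|/R_distinct[]//]|->]; constructor 1.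
Qed.

Lemma collinear_l x y : collinear x y x. Proof. by constructor 1. Qed.

Lemma collinear_r x y : collinear x y y. Proof. by constructor 2. Qed.

Lemma collinearC x y z : collinear x y z -> collinear y x z.
Proof.
by case=> [->|->|/R_swap12]; [constructor 2|constructor 1|constructor 3].
Qed.

(** When [z] and [w] are distinct and both differ from [x] and [y], this is the exchange axiom; the
    other cases are degenerate. *)
Lemma collinear_sub x y z w :
  collinear x y z -> z <> x -> collinear x y w -> collinear x z w.
Proof.
case=> [->|->//|Rxyz] // nzx [->|->|Rxyw]; first exact: collinear_l.
  by constructor 3; apply: R_swap23.
have [->|nzw] := pselect (z = w); first exact: collinear_r.
constructor 3; apply: R_swap23.
by case: KA => _ _; apply; [exact: Rxyz | exact: Rxyw | exact: nzw].
Qed.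

(** The second inclusion is [collinear_sub] with [y] and [z] interchanged: [y] lies in the span of
    [x] and [z], and [y = x] would force [z = x]. *)
Lemma collinear_replace x y z w : collinear x y z -> z <> x ->
  (collinear x y w <-> collinear x z w).
Proof.
move=> xyz nzx; split; first exact: collinear_sub.
have [yx|nyx] := pselect (y = x).
  by move: xyz; rewrite yx => /collinear_diag.
by apply: collinear_sub => //; apply: (collinear_sub xyz nzx); apply: collinear_r.
Qed.

(** Generators are replaced one at a time: [y] by [v], then [x] by [u]. If [v = x], replacing [y] by
    [u] suffices, up to the order of the pair. *)
Lemma collinear_exchange x y u v w :
    collinear x y u -> collinear x y v -> u <> v ->
  (collinear x y w <-> collinear u v w).
Proof.
move=> xyu xyv nuv; have [vx|nvx] := pselect (v = x).
  rewrite (collinear_replace w xyu); last by rewrite -vx.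
  by rewrite vx; split; apply: collinearC.
rewrite (collinear_replace w xyv nvx).
have vxu : collinear v x u by apply/collinearC/(collinear_replace _ xyv nvx).
split; first by move/collinearC/(collinear_replace _ vxu nuv)/collinearC.
by move/collinearC/(collinear_replace _ vxu nuv)/collinearC.
Qed.

(** The span of a diagonal pair is a singleton, and every span contains both of its generators. *)
Lemma span_diag x y u v : x = y ->
  (forall w, collinear x y w <-> collinear u v w) -> u = x /\ v = x.
Proof.
move=> <- E; split; apply/collinear_diag/E; [exact: collinear_l|exact: collinear_r].
Qed.

(** Hence being diagonal depends only on the span, so the sorts of the interpreted structure do not
    depend on the chosen pair. *)
Lemma span_eq_diag x y u v :
  (forall w, collinear x y w <-> collinear u v w) -> (x = y <-> u = v).
Proof.
move=> E; split=> H.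
  by have [-> ->] := span_diag H E.
have E' w : collinear u v w <-> collinear x y w by rewrite E.
by have [-> ->] := span_diag H E'.
Qed.

End OneSorted.

(** * Formulas, their semantics, and the two interpretations *)

Section Formulas.
Variables (L : language) (V : Type).

Definition FNot (f : formula L V) : formula L V := FImp f (FFalse L V).

Definition FIff (f g : formula L V) : formula L V := FAnd (FImp f g) (FImp g f).

Variables (A : structure L) (e : V -> A).

Lemma sat_FAnd (f g : formula L V) : sat (FAnd f g) e <-> sat f e /\ sat g e.
Proof. by []. Qed.

Lemma sat_FOr (f g : formula L V) : sat (FOr f g) e <-> sat f e \/ sat g e.
Proof. by []. Qed.

Lemma sat_FNot (f : formula L V) : sat (FNot f) e <-> ~ sat f e.
Proof. by []. Qed.

Lemma sat_FIff (f g : formula L V) :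
  sat (FIff f g) e <-> (sat f e <-> sat g e).
Proof. by split=> [[]|[]]; split. Qed.

Lemma sat_FAll (f : formula L (option V)) :
  sat (FAll f) e <-> forall a, sat f (oapp e a).
Proof. by []. Qed.

Lemma sat_FEx (f : formula L (option V)) :
  sat (FEx f) e <-> exists a, sat f (oapp e a).
Proof. by []. Qed.

End Formulas.

Definition Frel3 V (x y z : V) : formula tau V :=
  @FRel tau V Rsym (tnth [tuple x; y; z]).

Definition Fcollinear V (x y z : V) : formula tau V :=
  FOr (FEq tau z x) (FOr (FEq tau z y) (Frel3 x y z)).

Lemma sat_Fcollinear (A : structure tau) V (x y z : V) (e : V -> A) :
  sat (Fcollinear x y z) e <-> collinear (e x) (e y) (e z).
Proof.
rewrite /= [fun i => _]fun_ord3 -/(R _ _ _).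
split=> [[?|[?|?]]|[?|?|?]]; by [constructor 1|constructor 2|constructor 3|
  left|right; left|right; right].
Qed.

Definition Fpoint V (x : V) : formula tau_plus V :=
  @FRel tau_plus V Psym (tnth [tuple x]).

Definition Fincident V (x y : V) : formula tau_plus V :=
  @FRel tau_plus V Isym (tnth [tuple x; y]).

Lemma sat_Fpoint (B : structure tau_plus) V (x : V) (e : V -> B) :
  sat (Fpoint x) e <-> point (e x).
Proof. by rewrite /= [fun i => _]fun_ord1. Qed.

Lemma sat_Fincident (B : structure tau_plus) V (x y : V) (e : V -> B) :
  sat (Fincident x y) e <-> incident (e x) (e y).
Proof. by rewrite /= [fun i => _]fun_ord2. Qed.

(** The variable [existT _ i j] stands for coordinate [j] of the pair that codes argument [i]. *)
Definition spans_rel (r : tau_plus_symbol) :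
    formula tau {i : 'I_(@arity tau_plus r) & 'I_2} :=
  match r with
  | Psym => FEq tau (existT _ #0 #0) (existT _ #0 #1)
  | Lsym => FNot (FEq tau (existT _ #0 #0) (existT _ #0 #1))
  | Isym =>
      FAnd (FEq tau (existT _ #0 #0) (existT _ #0 #1))
        (FAnd (FNot (FEq tau (existT _ #1 #0) (existT _ #1 #1)))
          (Fcollinear (existT _ #1 #0) (existT _ #1 #1) (existT _ #0 #0)))
  end.

(** The domain formula is a tautology: every pair is a code. *)
Definition spans : interpretation tau tau_plus :=
  @Interpretation tau tau_plus unit (fun _ => 2)
    (fun _ => FEq tau #0 #0)
    (fun _ _ => FAll (FIff
       (Fcollinear (Some (inl #0)) (Some (inl #1)) None)
       (Fcollinear (Some (inr #0)) (Some (inr #1)) None)))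
    (fun r _ => spans_rel r).

Definition points_rel : formula tau_plus {i : 'I_3 & 'I_1} :=
  let x := existT (fun _ => 'I_1) #0 #0 in
  let y := existT (fun _ => 'I_1) #1 #0 in
  let z := existT (fun _ => 'I_1) #2 #0 in
  FAnd (FNot (FEq tau_plus x y))
    (FAnd (FNot (FEq tau_plus x z))
      (FAnd (FNot (FEq tau_plus y z))
        (FEx (FAnd (Fincident (Some x) None)
          (FAnd (Fincident (Some y) None) (Fincident (Some z) None)))))).

Definition points : interpretation tau_plus tau :=
  @Interpretation tau_plus tau unit (fun _ => 1)
    (fun _ => Fpoint #0)
    (fun _ _ => FEq tau_plus (inl #0) (inr #0))
    (fun r => match r with Rsym => fun _ => points_rel end).

(** * The two-sorted space of spans *)

Section Spans.
Variable A : structure tau.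
Implicit Types (x y u v : A) (p q : code spans A) (c d : interpret spans A).

Definition pair_code x y : code spans A :=
  existT (fun _ => 'I_2 -> A) tt (tnth [tuple x; y]).

Lemma pair_codeP p : exists x y, p = pair_code x y.
Proof. by case: p => -[] a; exists (a #0), (a #1); rewrite [a in LHS]fun_ord2. Qed.

Lemma tag_pair_code (t : unit) (f : 'I_2 -> A) :
  existT (fun _ => 'I_2 -> A) t f = pair_code (f #0) (f #1).
Proof. by case: t; rewrite [f in LHS]fun_ord2. Qed.

Lemma eqv_pair x y u v : eqv (pair_code x y) (pair_code u v) <->
  (forall w, collinear x y w <-> collinear u v w).
Proof.
rewrite /eqv sat_FAll.
by split=> E w; move: (E w); rewrite sat_FIff !sat_Fcollinear.
Qed.

Lemma rel_code_point x y : rel_code (r := Psym : symbol tau_plus) (tnth [tuple pair_code x y]) <-> x = y.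
Proof. by []. Qed.

Lemma rel_code_line x y : rel_code (r := Lsym : symbol tau_plus) (tnth [tuple pair_code x y]) <-> x <> y.
Proof. by []. Qed.

Lemma rel_code_incident x y u v :
  rel_code (r := Isym : symbol tau_plus) (tnth [tuple pair_code x y; pair_code u v]) <->
  [/\ x = y, u <> v & collinear u v x].
Proof.
rewrite /rel_code !sat_FAnd sat_Fcollinear.
by split=> [[? []]|[]]; do ?split.
Qed.

Hypothesis KA : one_sorted_linear_space A.

(** The sorts are invariant by [span_eq_diag]. For incidence, a pair equivalent to a diagonal pair
    is that same pair by [span_diag], and the pair coding the line enters only through its span. *)
Lemma spans_well_defined : well_defined spans A.
Proof.
split.
- by move=> p _; have [x [y ->]] := pair_codeP p; apply/eqv_pair.
- move=> p q _ _; have [x [y ->]] := pair_codeP p; have [u [v ->]] := pair_codeP q.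
  by move/eqv_pair => E; apply/eqv_pair => w; rewrite E.
- move=> p q s _ _ _; have [x [y ->]] := pair_codeP p.
  have [u [v ->]] := pair_codeP q; have [x' [y' ->]] := pair_codeP s.
  by move=> /eqv_pair E /eqv_pair E'; apply/eqv_pair => w; rewrite E.
case=> /= p q pq.
- rewrite [p]fun_ord1 [q]fun_ord1; have [_ _] := pq #0.
  have [x [y ->]] := pair_codeP (p #0); have [u [v ->]] := pair_codeP (q #0).
  by move=> /eqv_pair /(span_eq_diag KA) E /rel_code_point/E.
- rewrite [p]fun_ord1 [q]fun_ord1; have [_ _] := pq #0.
  have [x [y ->]] := pair_codeP (p #0); have [u [v ->]] := pair_codeP (q #0).
  by move=> /eqv_pair /(span_eq_diag KA) E /rel_code_line; rewrite E.
rewrite [p]fun_ord2 [q]fun_ord2; have [_ _] := pq #0; have [_ _] := pq #1.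
have [x [y ->]] := pair_codeP (p #0); have [u [v ->]] := pair_codeP (q #0).
have [x' [y' ->]] := pair_codeP (p #1); have [u' [v' ->]] := pair_codeP (q #1).
move=> /eqv_pair E' /eqv_pair E /rel_code_incident [xy nxy' xI].
apply/rel_code_incident; have [-> ->] := span_diag KA xy E.
by split=> //; [rewrite -(span_eq_diag KA E') | apply/E'].
Qed.

(** The lemmas on [spanned] turn equality, sorts and incidence of quotient elements into statements
    about generating pairs in [A]. *)
Definition spanned x y c := represents (pair_code x y) c.

Lemma spannedP c : exists x y, spanned x y c.
Proof.
have [p pc] := represents_surj spans_well_defined c.
by have [x [y E]] := pair_codeP p; exists x, y; rewrite /spanned -E.
Qed.

Lemma spanned_total x y : exists c, spanned x y c.
Proof. exact: (represents_total spans_well_defined). Qed.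

Lemma spanned_eq x y u v c d : spanned x y c -> spanned u v d ->
  (c = d <-> forall w, collinear x y w <-> collinear u v w).
Proof.
move=> xc ud; rewrite -eqv_pair; exact: (represents_eq spans_well_defined).
Qed.

Lemma spanned_point x y c : spanned x y c -> (point c <-> x = y).
Proof.
move=> xc; rewrite -rel_code_point; apply: (holds_represents spans_well_defined).
by case=> -[].
Qed.

Lemma spanned_line x y c : spanned x y c -> (line c <-> x <> y).
Proof.
move=> xc; rewrite -rel_code_line; apply: (holds_represents spans_well_defined).
by case=> -[].
Qed.

Lemma spanned_incident x y u v c d : spanned x y c -> spanned u v d ->
  (incident c d <-> [/\ x = y, u <> v & collinear u v x]).
Proof.
move=> xc ud; rewrite -rel_code_incident.
apply: (holds_represents spans_well_defined).
by case=> -[|[]].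
Qed.

(** The line joining the points coded by [(x, x)] and [(u, u)] is coded by [(x, u)], and
    [collinear_exchange] makes it unique. A line coded by [(x, y)] contains the points of its two
    generators. *)
Lemma spans_two_sorted : two_sorted_linear_space (interpret spans A).
Proof.
split.
- move=> c; have [x [y xc]] := spannedP c.
  rewrite (spanned_point xc) (spanned_line xc); split; last by case.
  by have [] := pselect (x = y); [left | right].
- move=> c d; have [x [y xc]] := spannedP c; have [u [v ud]] := spannedP d.
  by rewrite (spanned_incident xc ud) (spanned_point xc) (spanned_line ud) => -[].
- move=> c d; have [x [y xc]] := spannedP c; have [u [v ud]] := spannedP d.
  rewrite (spanned_point xc) (spanned_point ud) => xy uv; subst y v => ncd.
  have nxu : x <> u by move=> xu; subst u; apply/ncd/(spanned_eq xc ud).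
  have [l xul] := spanned_total x u; exists l; split.
    split; [exact/(spanned_line xul) | apply/(spanned_incident xc xul)
           | apply/(spanned_incident ud xul)].
      by split=> //; apply: collinear_l.
    by split=> //; apply: collinear_r.
  move=> m [_]; have [y [v yvm]] := spannedP m.
  rewrite (spanned_incident xc yvm) (spanned_incident ud yvm) => -[_ _ yvx] [_ _ yvu].
  by apply/(spanned_eq xul yvm) => w; rewrite -(collinear_exchange KA w yvx yvu nxu).
move=> l; have [x [y xyl]] := spannedP l; rewrite (spanned_line xyl) => nxy.
have [c xc] := spanned_total x x; have [d yd] := spanned_total y y; exists c, d.
split.
- exact/(spanned_point xc).
- exact/(spanned_point yd).
(* If the two points were equal, [y] would belong to the singleton spanned by [(x, x)]. *)
- by move/(spanned_eq xc yd)/(_ y)/iffRL/(_ (collinear_l _ _))/(collinear_diag KA)/esym.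
- by apply/(spanned_incident xc xyl); split=> //; apply: collinear_l.
- by apply/(spanned_incident yd xyl); split=> //; apply: collinear_r.
Qed.

End Spans.

(** * The one-sorted space of points *)

Section Points.
Variable B : structure tau_plus.
Hypothesis KB : two_sorted_linear_space B.
Implicit Types (x y z l m : B) (p q : code points B) (c d : interpret points B).

Definition point_code x : code points B :=
  existT (fun _ => 'I_1 -> B) tt (tnth [tuple x]).

Lemma point_codeP p : exists x, p = point_code x.
Proof. by case: p => -[] a; exists (a #0); rewrite [a in LHS]fun_ord1. Qed.

Lemma in_dom_point x : in_dom (point_code x) <-> point x.
Proof. exact: sat_Fpoint. Qed.

Lemma tag_point_code (t : unit) (f : 'I_1 -> B) :
  existT (fun _ => 'I_1 -> B) t f = point_code (f #0).
Proof. by case: t; rewrite [f in LHS]fun_ord1. Qed.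

Lemma eqv_point x y : eqv (point_code x) (point_code y) <-> x = y.
Proof. by []. Qed.

Definition on_line x y z :=
  [/\ x <> y, x <> z, y <> z &
      exists l, [/\ incident x l, incident y l & incident z l]].

Lemma rel_code_on_line x y z :
  rel_code (r := Rsym : symbol tau) (tnth [tuple point_code x; point_code y; point_code z]) <->
  on_line x y z.
Proof.
rewrite /rel_code !sat_FAnd sat_FEx; split=> [[? [? [? [l]]]]|[? ? ? [l [? ? ?]]]].
  by rewrite !sat_FAnd !sat_Fincident => -[? [? ?]]; split=> //; exists l.
by do 3!split=> //; exists l; rewrite !sat_FAnd !sat_Fincident.
Qed.

(** The equivalence formula is equality of the single coordinate, so equivalent codes are equal and
    invariance is immediate. *)
Lemma points_well_defined : well_defined points B.
Proof.
split.
- by [].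
- by move=> p q _ _; have [x ->] := point_codeP p; have [y ->] := point_codeP q;
  rewrite !eqv_point.
- move=> p q s _ _ _; have [x ->] := point_codeP p; have [y ->] := point_codeP q.
  by have [z ->] := point_codeP s; rewrite !eqv_point => ->.
case=> p q pq; suff -> : p = q by [].
apply/funext => i; have [_ _] := pq i.
by have [x ->] := point_codeP (p i); have [y ->] := point_codeP (q i) => /eqv_point ->.
Qed.

Definition named x c := represents (point_code x) c.

Lemma named_is_point x c : named x c -> point x.
Proof. by move/represents_in_dom/in_dom_point. Qed.

Lemma namedP c : exists x, named x c.
Proof.
have [p pc] := represents_surj points_well_defined c.
by have [x E] := point_codeP p; exists x; rewrite /named -E.
Qed.

Lemma named_total x : point x -> exists c, named x c.
Proof. by move/in_dom_point; apply: (represents_total points_well_defined). Qed.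

Lemma named_eq x y c d : named x c -> named y d -> (c = d <-> x = y).
Proof.
move=> xc yd; rewrite -eqv_point; exact: (represents_eq points_well_defined).
Qed.

Lemma named_R x y z c d e : named x c -> named y d -> named z e ->
  (R c d e <-> on_line x y z).
Proof.
move=> xc yd ze; rewrite -rel_code_on_line.
by apply: (holds_represents points_well_defined); case=> -[|[|[]]].
Qed.

(** In this form, invariance under permutations of the three arguments is evident. *)
Lemma on_line_ord3 (x : 'I_3 -> B) : on_line (x #0) (x #1) (x #2) <->
  (injective x /\ exists l, forall i, incident (x i) l).
Proof.
split=> [[n01 n02 n12 [l [l0 l1 l2]]]|[x_inj [l xl]]]; last first.
  by split; [move/x_inj | move/x_inj | move/x_inj | exists l].
rewrite [x]fun_ord3; split; last by exists l; case=> -[|[|[]]].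
by case=> -[|[|[|//]]] ?; case=> -[|[|[|//]]] ?; rewrite /tnth /= => ?;
  apply: val_inj => //=; exfalso; auto.
Qed.

Lemma incident_point x l : incident x l -> point x.
Proof. by case: KB => _ + _ _ => /[apply] -[]. Qed.

Lemma incident_line x l : incident x l -> line l.
Proof. by case: KB => _ + _ _ => /[apply] -[]. Qed.

Lemma not_point_line x : point x -> ~ line x.
Proof. by case: KB => /(_ x)[_ npl] _ _ _ px lx; apply: npl. Qed.

Lemma line_unique x y l m : x <> y ->
  incident x l -> incident y l -> incident x m -> incident y m -> l = m.
Proof.
move=> nxy xl yl xm ym; case: KB => _ _ join _.
have [k [_ uniq]] := join _ _ (incident_point xl) (incident_point yl) nxy.
by rewrite -(uniq l) ?(uniq m) //; split=> //; [apply: incident_line xm | apply: incident_line xl].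
Qed.

(** Symmetry comes from [on_line_ord3]. For exchange, the line of [x], [y], [z] and that of [x],
    [y], [w] share two distinct points, hence coincide. *)
Lemma points_one_sorted : one_sorted_linear_space (interpret points B).
Proof.
split.
- move=> c d e; have [[x xc] [y yd]] := (namedP c, namedP d).
  have [z ze] := namedP e; move/(named_R xc yd ze) => [nxy nxz nyz _].
  by split; [move/(named_eq xc yd) | move/(named_eq xc ze) | move/(named_eq yd ze)].
- move=> s v; have [x xv] := choice (fun i => namedP (v i)).
  (* An arbitrary reindexing [t] allows the use both at the identity and at [s]. *)
  have relE (t : 'I_3 -> 'I_3) :
      @holds tau (interpret points B) Rsym (fun i => v (t i)) <->
      on_line (x (t #0)) (x (t #1)) (x (t #2)).
    by rewrite [fun i => _]fun_ord3; apply: named_R.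
  rewrite (relE id) (relE s).
  rewrite (on_line_ord3 x) (on_line_ord3 (x \o s)) => -[x_inj [l xl]].
  by split; [apply: inj_comp x_inj perm_inj | exists l => i; apply: xl].
- move=> c d e f; have [[x xc] [y yd]] := (namedP c, namedP d).
  have [[z ze] [w wf]] := (namedP e, namedP f).
  rewrite (named_R xc yd ze) (named_R xc yd wf) (named_R xc wf ze) (named_eq ze wf).
  case=> nxy nxz nyz [l [xl yl zl]] [_ nxw nyw [m [xm ym wm]]] nzw.
  split=> //; first exact: nesym.
  by exists l; split=> //; rewrite (line_unique nxy xl yl xm ym).
Qed.

End Points.

(** * Recovering a one-sorted space from the points among its spans *)

Definition decode_point : graph_formulas spans points := fun _ _ =>
  let x := existT (fun _ : 'I_1 => 'I_2) #0 #0 in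
  let y := existT (fun _ : 'I_1 => 'I_2) #0 #1 in
  FAnd (FEq tau (Some x) None) (FEq tau (Some y) None).

Section OneSortedRoundTrip.
Variable A : structure tau.
Hypothesis KA : one_sorted_linear_space A.
Let B := interpret spans A.

(** An element of the double interpretation names an element [b] of [B], itself a class of pairs; it
    decodes to the [x] whose diagonal pair lies in that class. *)
Definition decodes_point (c : interpret points B) (x : A) : Prop :=
  exists2 b : B, spanned x x b & named b c.

Lemma spanned_diag_eq (x y : A) (b c : B) :
  spanned x x b -> spanned y y c -> (b = c <-> x = y).
Proof.
move=> xb yc; rewrite (spanned_eq KA xb yc).
by split=> [/(_ x)/iffLR/(_ (collinear_l _ _))/(collinear_diag KA)//|->].
Qed.

(** A line [l] through the three points is also spanned by [x] and [y], by exchange, and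
    distinctness leaves only the case [R x y z]. Conversely, the span of [x] and [y] is a common
    line. *)
Lemma points_spans_on_line (x y z : A) (b c d : B) :
  spanned x x b -> spanned y y c -> spanned z z d ->
  (on_line b c d <-> R x y z).
Proof.
move=> xb yc zd; split.
  case=> /(spanned_diag_eq xb yc) nxy /(spanned_diag_eq xb zd) nxz.
  move=> /(spanned_diag_eq yc zd) nyz [l]; have [u [v uvl]] := spannedP KA l.
  case=> /(spanned_incident KA xb uvl)[_ _ ux] /(spanned_incident KA yc uvl)[_ _ uy].
  move=> /(spanned_incident KA zd uvl)[_ _ /(collinear_exchange KA z ux uy nxy)].
  by case=> // /esym.
move=> Rxyz; have [nxy nxz nyz] := R_distinct KA Rxyz.
split; [by move/(spanned_diag_eq xb yc) | by move/(spanned_diag_eq xb zd)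
       | by move/(spanned_diag_eq yc zd) | ].
have [l xyl] := spanned_total KA x y; exists l.
split; [apply/(spanned_incident KA xb xyl) | apply/(spanned_incident KA yc xyl)
       | apply/(spanned_incident KA zd xyl)]; split=> //.
- exact: collinear_l.
- exact: collinear_r.
- by constructor 3.
Qed.

(** Both interpretations have a single piece, so a code of a code is just an explicit pair of
    elements of [A]. *)
Lemma represents2_points (q : piece points) (p : 'I_(dim q) -> piece spans)
    (a : {i : 'I_(dim q) & 'I_(dim (p i))} -> A) (c : interpret points B) :
  represents2 a c <->
  exists2 b : B, spanned (a (existT _ #0 #0)) (a (existT _ #0 #1)) b & named b c.
Proof.
case: q p a => p a; split=> [[b ab bc]|[b ab bc]].
  exists (b #0); first by have := ab #0; rewrite tag_pair_code.
  by move: bc; rewrite tag_point_code.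
exists (fun _ => b); last by rewrite tag_point_code.
(* The bound proof [i] inside the ordinal must be identified with the one in [#0]. *)
by case=> -[|//] i; rewrite tag_pair_code (bool_irrelevance i isT).
Qed.

Lemma one_sorted_round_trip :
  exists2 f : interpret points B -> A,
    is_isomorphism f & defines_map decode_point f.
Proof.
have wdF := spans_well_defined KA; have wdG := @points_well_defined B.
apply: (@definable_isomorphism _ _ _ _ _ _ decodes_point).
- move=> c; have [b bc] := namedP c.
  have := named_is_point bc; have [x [y xyb]] := spannedP KA b.
  by move/(spanned_point KA xyb) => xy; subst y; exists x, b.
- move=> x; have [b xb] := spanned_total KA x x.
  have [c bc] : exists c, named b c by apply/named_total/(spanned_point KA xb).
  by exists c, b.
- move=> c d x y [b xb bc] [e ye ed].
  by rewrite (named_eq bc ed) (spanned_diag_eq xb ye).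
- case=> c x cx; rewrite [c]fun_ord3 [x]fun_ord3.
  have [[b0 x0 c0] [b1 x1 c1] [b2 x2 c2]] := And3 (cx #0) (cx #1) (cx #2).
  exact: iff_trans (named_R c0 c1 c2) (points_spans_on_line x0 x1 x2).
move=> [] p a x; rewrite sat_FAnd; split=> [[ax ax']|[c]].
  have [b xb] := spanned_total KA x x.
  have [c bc] : exists c, named b c by apply/named_total/(spanned_point KA xb).
  exists c; last by exists b.
  by apply/represents2_points; exists b => //; rewrite [a _]ax [a _]ax'.
case/represents2_points => b ab bc [e xe ec].
have E : e = b by apply/(named_eq ec bc).
(* The given pair spans the same set as [(x, x)], so both of its coordinates are [x]. *)
by move: ab; rewrite -E => /(spanned_eq KA xe)/iffLR/(_ erefl)/(span_diag KA erefl).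
Qed.

End OneSortedRoundTrip.

(** * Recovering a two-sorted space from the spans of its points *)

Definition decode_line : graph_formulas points spans := fun _ _ =>
  let x := Some (existT (fun _ : 'I_2 => 'I_1) #0 #0) in
  let y := Some (existT (fun _ : 'I_2 => 'I_1) #1 #0) in
  FAnd (FAnd (Fpoint x) (Fpoint y))
    (FOr (FAnd (FEq tau_plus x y) (FEq tau_plus None x))
      (FAnd (FNot (FEq tau_plus x y))
        (FAnd (Fincident x None) (Fincident y None)))).

Section TwoSortedRoundTrip.
Variable B : structure tau_plus.
Hypothesis KB : two_sorted_linear_space B.
Let A := interpret points B.
Let KA : one_sorted_linear_space A := points_one_sorted KB.
Implicit Types (x y z w : B) (b d e : A).

(** This is the element coded by a pair of points: the point itself on the diagonal, the line
    through both otherwise. It is the core of [decode_line], whose additional guards reject tuples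
    outside the domain of [points]. *)
Definition joins x y z :=
  x = y /\ z = x \/ [/\ x <> y, incident x z & incident y z].

Lemma joins_point x y z : point x -> joins x y z -> (point z <-> x = y).
Proof.
move=> px [[xy ->]|[nxy xz _]]; first by split.
by split=> // /(not_point_line KB)/(_ (incident_line KB xz)).
Qed.

Lemma joins_line x y z : point x -> joins x y z -> (line z <-> x <> y).
Proof.
move=> px [[xy ->]|[nxy xz _]]; last by split=> // _; apply: incident_line xz.
by split=> // /(not_point_line KB px).
Qed.

(** The alternative [w = z] accounts for a point [z], incidence for a line [z]; disjointness of the
    sorts rules out the mixed cases. *)
Lemma joins_collinear x y z w b d e : named x b -> named y d -> named w e ->
  joins x y z -> (collinear b d e <-> w = z \/ incident w z).
Proof.
move=> xb yd we; case=> [[xy ->]|[nxy xz yz]].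
  subst y; rewrite (_ : d = b); last exact/(named_eq yd xb).
  rewrite (collinear_diag KA) (named_eq we xb); split=> [|[//|]]; first by left.
  by move/(incident_line KB)/(not_point_line KB (named_is_point xb)).
split=> [|[wz|wz]].
- case; [move/(named_eq we xb)|move/(named_eq we yd)|]; try by move->; right.
  case/(named_R xb yd we) => _ _ _ [l [xl yl wl]].
  by right; rewrite (line_unique KB nxy xz yz xl yl).
(* Here [w = z] is absurd: [w] is a point and [z] a line. *)
- have := not_point_line KB (named_is_point we).
  by rewrite wz; case; apply: incident_line xz.
have [/(named_eq we xb)|nwx] := pselect (w = x); first by constructor 1.
have [/(named_eq we yd)|nwy] := pselect (w = y); first by constructor 2.
constructor 3; apply/(named_R xb yd we).
by split=> //; [exact: nesym | exact: nesym | exists z].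
Qed.

Definition decodes_line (c : interpret spans A) z :=
  exists x y b d, [/\ named x b, named y d, spanned b d c & joins x y z].

Lemma joins_total x y : point x -> point y -> exists z, joins x y z.
Proof.
move=> px py; have [xy|nxy] := pselect (x = y); first by exists x; left.
case: (KB) => _ _ join _; have [l [[_ xl yl] _]] := join _ _ px py nxy.
by exists l; right.
Qed.

(** By [joins_collinear], [z] determines the span. Conversely, equal spans are both diagonal, giving
    the same point, or both lines; then the distinct points [x'] and [y'] lie on [z] and on [z'],
    which must coincide. *)
Lemma decodes_line_eq c c' z z' : decodes_line c z -> decodes_line c' z' ->
  (c = c' <-> z = z').
Proof.
case=> x [y [b [d [xb yd bdc xyz]]]] [x' [y' [b' [d' [xb' yd' bdc' xyz']]]]].
rewrite (spanned_eq KA bdc bdc'); split=> [E|zz' e]; last first.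
  have [w we] := namedP e.
  by rewrite (joins_collinear xb yd we xyz) (joins_collinear xb' yd' we xyz') zz'.
have diag := span_eq_diag KA E.
rewrite (named_eq xb yd) (named_eq xb' yd') in diag.
case: xyz' => [[xy' ->]|[nxy' xz' yz']].
  case: xyz => [[xy ->]|[nxy _ _]]; last by case: nxy; apply/diag.
  apply/(named_eq xb xb'); apply/esym.
  by have [] := span_diag KA ((named_eq xb yd).2 xy) E.
(* If [w = z], then [z] is a point, so [x = y] and hence [x' = y'], against [nxy']. *)
have on_z w e : named w e -> collinear b' d' e -> incident w z.
  move=> we /E/(joins_collinear xb yd we xyz)[wz|//].
  have /(joins_point (named_is_point xb) xyz)/diag : point z.
    by rewrite -wz; apply: named_is_point we.
  by [].
apply: (line_unique KB nxy') => //; [apply: on_z xb' _ | apply: on_z yd' _].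
  exact: collinear_l.
exact: collinear_r.
Qed.

Lemma represents2_spans (q : piece spans) (p : 'I_(dim q) -> piece points)
    (a : {i : 'I_(dim q) & 'I_(dim (p i))} -> B) (c : interpret spans A) :
  represents2 a c <->
  exists b d : A, [/\ named (a (existT _ #0 #0)) b, named (a (existT _ #1 #0)) d
                    & spanned b d c].
Proof.
case: q p a => p a; split=> [[b ab bc]|[b [d [ab ad bdc]]]].
  exists (b #0), (b #1); split; last by move: bc; rewrite tag_pair_code.
    by have := ab #0; rewrite tag_point_code.
  by have := ab #1; rewrite tag_point_code.
exists (tnth [tuple b; d]) => //.
by case=> -[|[|[]]] // i; rewrite tag_point_code (bool_irrelevance i isT).
Qed.

Lemma two_sorted_round_trip :
  exists2 f : interpret spans A -> B,
    is_isomorphism f & defines_map decode_line f.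
Proof.
apply: (@definable_isomorphism _ _ _ _ _ _ decodes_line).
- move=> c; have [b [d bdc]] := spannedP KA c.
  have [[x xb] [y yd]] := (namedP b, namedP d).
  have [z xyz] := joins_total (named_is_point xb) (named_is_point yd).
  by exists z, x, y, b, d.
(* A point is decoded from its diagonal pair, a line from two of its points given by axiom (B). *)
- move=> z; suff [x [y [px py xyz]]] : exists x y, [/\ point x, point y & joins x y z].
    have [[b xb] [d yd]] := (named_total px, named_total py).
    by have [c bdc] := spanned_total KA b d; exists c, x, y, b, d.
  case: (KB) => /(_ z)[[pz _|lz _]] _ _ two_points; first by exists z, z; split=> //; left.
  by have [x [y [px py nxy xz yz]]] := two_points _ lz; exists x, y; split=> //; right.
- exact: decodes_line_eq.
- have decode_point_line c z : decodes_line c z ->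
      (point c <-> point z) /\ (line c <-> line z).
    case=> x [y [b [d [xb yd bdc xyz]]]].
    rewrite (joins_point (named_is_point xb) xyz) (joins_line (named_is_point xb) xyz).
    by rewrite (spanned_point KA bdc) (spanned_line KA bdc) (named_eq xb yd).
  case=> /= c z cz; [rewrite [c]fun_ord1 [z]fun_ord1..|rewrite [c]fun_ord2 [z]fun_ord2].
  + by have [] := decode_point_line _ _ (cz #0).
  + by have [] := decode_point_line _ _ (cz #0).
  have [x [y [b [d [xb yd bdc xyz]]]]] := cz #0.
  have [x' [y' [b' [d' [xb' yd' bdc' xyz']]]]] := cz #1.
  move: (c #0) (c #1) (z #0) (z #1) bdc bdc' xyz xyz'.
  move=> {cz}{}c c' {}z z' bdc bdc' xyz xyz'.
  apply: iff_trans (spanned_incident KA bdc bdc') _.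
  have px := named_is_point xb; have px' := named_is_point xb'.
  split=> [[/(named_eq xb yd) xy nbd' bI]|zz'].
    have xz : z = x by case: xyz => [[]|[]].
    case/(joins_collinear xb' yd' xb xyz'): bI; rewrite xz // => xz'.
    (* The point [x] cannot equal [z'], which is a line because [x'] and [y'] differ. *)
    case: (not_point_line KB px); rewrite xz'; apply/(joins_line px' xyz').
    by move/(named_eq xb' yd').
  have /(joins_line px' xyz') nxy' := incident_line KB zz'.
  have /(joins_point px xyz) xy := incident_point KB zz'.
  split; [exact/(named_eq xb yd) | by move/(named_eq xb' yd') | ].
  apply/(joins_collinear xb' yd' xb xyz'); right.
  by case: xyz => [[_ <-]|[]].
move=> [] p a z; rewrite !sat_FAnd sat_FOr !sat_FAnd sat_FNot !sat_Fpoint !sat_Fincident.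
set x := a (existT _ #0 #0); set y := a (existT _ #1 #0).
split=> [[[px py] xyz]|[c]].
  have [[b xb] [d yd]] := (named_total px, named_total py).
  have [c bdc] := spanned_total KA b d.
  exists c; first by apply/represents2_spans; exists b, d.
  by exists x, y, b, d; split=> //; case: xyz => [|[? []]]; [left | right].
case/represents2_spans => b [d [xb yd bdc]] cz.
have [px py] := (named_is_point xb, named_is_point yd); split=> //.
(* The pair joins to some [z']; since [c] decodes to both [z'] and [z], they agree. *)
have [z' xyz'] := joins_total px py.
have cz' : decodes_line c z' by exists x, y, b, d.
have <- := (decodes_line_eq cz' cz).1 erefl.
by case: xyz' => [|[? ? ?]]; [left | right].
Qed.

End TwoSortedRoundTrip.

Theorem theorem2p9 :
  exists (F : interpretation tau tau_plus) (G : interpretation tau_plus tau),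
    [/\ interprets_class F one_sorted_linear_space two_sorted_linear_space,
        interprets_class G two_sorted_linear_space one_sorted_linear_space,
        definably_isomorphic_on F G one_sorted_linear_space
      & definably_isomorphic_on G F two_sorted_linear_space].
Proof.
exists spans, points; split.
- by move=> A KA; split; [apply: spans_well_defined | apply: spans_two_sorted].
- by move=> B KB; split; [apply: points_well_defined | apply: points_one_sorted].
- by exists decode_point => A KA; apply: one_sorted_round_trip.
- by exists decode_line => B KB; apply: two_sorted_round_trip.
Qed.
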